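(* Let $n\geq 4$ and let $(G;\{\rho_0,\ldots,\rho_{n-1}\})$ be an irreducible string C-group of rank $n$. If $\rho_2\rho_3$ has odd order, then $(G;\{\rho_1,\rho_0\rho_2,\rho_3,\ldots,\rho_{n-1}\})$ (with the generators taken in the order $\rho_1,\ \rho_0\rho_2,\ \rho_3,\ \ldots,\ \rho_{n-1}$) is a string C-group of rank $n-1$.
   Context: A pair $(G;\{\rho_0,\ldots,\rho_{n-1}\})$, where $G$ is a group and $\rho_0,\ldots,\rho_{n-1}$ is an ordered sequence of elements of $G$, is a string group generated by involutions (sggi) if $G=\langle\rho_0,\ldots,\rho_{n-1}\rangle$, each $\rho_i$ is an involution (an element of order exactly 2), and the commuting property holds: for all $i,j\in\{0,\ldots,n-1\}$ with $|i-j|>1$, $(\rho_i\rho_j)^2=1$. An sggi is a string C-group, of rank $n$, if it also satisfies the intersection property: for all $I,J\subseteq\{0,\ldots,n-1\}$, $\langle\rho_i\mid i\in I\rangle\cap\langle\rho_j\mid j\in J\rangle=\langle\rho_k\mid k\in I\cap J\rangle$. It is irreducible if the order of $\rho_i\rho_{i+1}$ is greater than 2 for all $0\leq i\leq n-2$. ''Odd order'' means finite odd order. *)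

(* Defs.v *)
From mathcomp Require Import all_boot.
From mathcomp Require Import boolp classical_sets.

Set Implicit Arguments.
Unset Strict Implicit.
Unset Printing Implicit Defensive.

Local Open Scope classical_set_scope.
Local Open Scope group_scope.

Section StringCGroup.
Variable G : groupType.
Implicit Types (x : G) (H S : set G) (n k : nat) (rho : seq G).

Definition subgroup H : Prop :=
  [/\ H 1, forall x y, H x -> H y -> H (x * y) & forall x, H x -> H x^-1].

Definition generated S : set G := smallest subgroup S.

(* [G] may be infinite: an element of infinite order satisfies [has_order x k]
   for no [k]. *)
Definition has_order x k : Prop :=
  [/\ (0 < k)%N, x ^+ k = 1 & forall j, (0 < j < k)%N -> x ^+ j <> 1].

Definition odd_order x : Prop := exists2 k, has_order x k & odd k.

(* Elements of infinite order are included. *)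
Definition order_gt x m : Prop := forall k, has_order x k -> (m < k)%N.

Definition involution x : Prop := has_order x 2.

(* The ordered generators are the entries rho`_0, ..., rho`_n.-1. *)
Definition sggi n rho : Prop :=
  [/\ size rho = n,
      generated [set rho`_i | i in `I_n] = [set: G],
      forall i, (i < n)%N -> involution rho`_i &
      forall i j, (i < n)%N -> (j < n)%N -> (i.+1 < j)%N || (j.+1 < i)%N ->
        (rho`_i * rho`_j) ^+ 2 = 1].

Definition intersection_property n rho : Prop :=
  forall I J : set nat, I `<=` `I_n -> J `<=` `I_n ->
    generated [set rho`_i | i in I] `&` generated [set rho`_j | j in J] =
    generated [set rho`_k | k in I `&` J].

Definition string_Cgroup n rho : Prop :=
  sggi n rho /\ intersection_property n rho.

Definition irreducible n rho : Prop :=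
  forall i, (i.+1 < n)%N -> order_gt (rho`_i * rho`_i.+1) 2.

End StringCGroup.

(* Main.v *)
Require Import Defs.
From mathcomp Require Import all_boot.
From mathcomp Require Import boolp classical_sets.

(** Write r_0, r_1, ... for the given generators and s_0 = r_1, s_1 = r_0 r_2,
    s_k = r_(k+1) for k >= 2 for the new ones. Since r_0 commutes with r_2 and
    r_3, an odd exponent k with (r_2 r_3)^k = 1 gives (r_0 r_2 r_3)^k = r_0; so
    r_0 lies in <s_1, s_2>, and this membership is all that the general
    statement [rank_reduction] asks for. It implies that the s_k generate the
    group.

    For the intersection property, replace each s_k by the r_j occurring in it:
    <s_i | i in I> is contained in the standard parabolic subgroup on the set
    [hull I] of these indices j, and [hull] commutes with intersections. Hence
    an element of <s_i | i in I> and <s_j | j in J> lies in the parabolic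
    subgroup on hull (I & J). By the membership above this parabolic subgroup is
    <s_k | k in I & J>, unless I & J contains 1 but not 2, and then one of I and
    J, say I, misses 2. Now the generators s_0, s_1 commute with the s_i, i >= 3,
    so the element is a product g h with g in <s_0, s_1> and h in
    <s_i | i >= 3>; it splits likewise along hull (I & J), and both splittings
    agree because <r_0, r_1, r_2> and <r_4, r_5, ...> meet trivially. All is
    then clear ([sigma_cap_hull]) except when 0 is not in I & J, where
    g lies both in the dihedral group <r_1, r_0 r_2> and in the Klein group
    <r_0, r_2>. If g were r_0 or r_2, it would commute with the reflection
    r_0 r_2, which in a dihedral group forces r_0 or r_2 to be central
    ([commute_dihedral]), hence to commute with r_1; irreducibility excludes
    this. So g is 1 or s_1. *)

Set Implicit Arguments.
Unset Strict Implicit.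

Local Open Scope classical_set_scope.
Local Open Scope group_scope.

(** * Generated subgroups *)

Section Generated.
Variable G : groupType.
Implicit Types (x y : G) (H S T : set G).

Lemma subgroup_generated S : subgroup (generated S).
Proof.
split=> [H [[H1 _ _] _] //|x y Sx Sy H HS|x Sx H HS].
  by case: (HS) => -[_ HM _] _; apply: HM; [exact: Sx|exact: Sy].
by case: (HS) => -[_ _ HV] _; apply: HV; exact: Sx.
Qed.

Lemma generated1 S : generated S 1.
Proof. by case: (subgroup_generated S). Qed.

Lemma generatedM S x y : generated S x -> generated S y -> generated S (x * y).
Proof. by case: (subgroup_generated S) => _ + _; apply. Qed.

Lemma generatedV S x : generated S x -> generated S x^-1.
Proof. by case: (subgroup_generated S) => _ _; apply. Qed.

Lemma sub_generated S : S `<=` generated S.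
Proof. exact: sub_gen_smallest. Qed.

Lemma generated_sub S H : subgroup H -> S `<=` H -> generated S `<=` H.
Proof. exact: smallest_sub. Qed.

Lemma generated_le S T : S `<=` generated T -> generated S `<=` generated T.
Proof. by apply: generated_sub; exact: subgroup_generated. Qed.

Lemma subgroup_centralizer T : subgroup [set x | forall t, T t -> commute x t].
Proof.
split=> [t _|x y Cx Cy t Tt|x Cx t Tt]; apply/commute_sym.
- exact: commute1.
- by apply: commuteM; apply: commute_sym; [apply: Cx|apply: Cy].
- by apply: commuteV; apply: commute_sym; apply: Cx.
Qed.

Lemma commute_generated S T :
  (forall s t, S s -> T t -> commute s t) ->
  forall x y, generated S x -> generated T y -> commute x y.
Proof.
move=> cST x y Sx Ty; apply: commute_sym; move: x Sx.
suff: generated T `<=` [set u | forall x, generated S x -> commute u x].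
  exact.
apply: generated_sub; first exact: subgroup_centralizer.
move=> t Tt x Sx; apply: commute_sym; move: x Sx t Tt.
suff: generated S `<=` [set u | forall t, T t -> commute u t] by exact.
by apply: generated_sub => [|s Ss t]; [exact: subgroup_centralizer|exact: cST].
Qed.

Lemma generated_setU S T :
  (forall s t, S s -> T t -> commute s t) ->
  forall x, generated (S `|` T) x ->
  exists g h, [/\ generated S g, generated T h & x = g * h].
Proof.
move=> /commute_generated cST.
suff: generated (S `|` T) `<=`
  [set x | exists g h, [/\ generated S g, generated T h & x = g * h]] by exact.
apply: generated_sub => [|x [Sx|Tx]]; last 2 first.
- by exists x, 1; rewrite mulg1; split=> //; [exact: sub_generated|exact: generated1].
- by exists 1, x; rewrite mul1g; split=> //; [exact: generated1|exact: sub_generated].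
split=> [|_ _ [g] [h] [Sg Th ->] [g'] [h'] [Sg' Th' ->]|_ [g] [h] [Sg Th ->]].
- by exists 1, 1; rewrite mulg1; split=> //; exact: generated1.
- exists (g * g'), (h * h'); split; [exact: generatedM|exact: generatedM|].
  by rewrite !mulgA -(mulgA g h) -(cST _ _ Sg' Th) !mulgA.
- exists g^-1, h^-1; split; [exact: generatedV|exact: generatedV|].
  by rewrite (cST _ _ Sg Th) invgM.
Qed.

Lemma generated_set1 x : x * x = 1 -> generated [set x] `<=` [set 1; x].
Proof.
move=> xx; have xV : x^-1 = x by exact: mulg1_eq.
apply: generated_sub => [|y ->]; last by right.
split=> [|y z [] -> [] ->|y [] ->]; rewrite ?mul1g ?mulg1 ?invg1 ?xx ?xV;
  by [left|right].
Qed.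

End Generated.

(** * Dihedral groups *)

Section Dihedral.
Variable G : groupType.
Implicit Types a b c p q x y u v : G.

(** A rotation commuting with the reflection b is central, and c or c * b is a
    rotation. The group may be infinite: the rotations are taken to be the
    elements of the double centralizer of a * b that b inverts, which form an
    abelian group without any reference to powers. *)
Lemma commute_dihedral a b c :
  a * a = 1 -> b * b = 1 -> generated [set a; b] c -> commute c b ->
  commute c a \/ commute (c * b) a.
Proof.
move=> aa bb.
have aV : a^-1 = a by exact: mulg1_eq.
have bV : b^-1 = b by exact: mulg1_eq.
have bK x : x * b * b = x by rewrite -mulgA bb mulg1.
pose N x :=
  (forall y, commute y (a * b) -> commute x y) /\ b * x * b = x^-1.
have NC x y : N x -> N y -> commute x y.
  move=> [cx _] [cy _]; apply: cx; exact: cy.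
have N1 : N 1 by split=> [y _|]; [exact/commute_sym/commute1|rewrite mulg1 bb invg1].
have NM x y : N x -> N y -> N (x * y).
  move=> Nx Ny; have xy := NC _ _ Nx Ny; case: Nx Ny => [cx ix] [cy iy]; split.
    move=> z rz; apply: commute_sym; apply: commuteM; apply: commute_sym.
      exact: cx.
    exact: cy.
  by rewrite {2}xy invgM -ix -iy !mulgA bK.
have NV x : N x -> N x^-1.
  move=> [cx ix]; split=> [z rz|].
    by apply: commute_sym; apply: commuteV; apply/commute_sym/cx.
  by rewrite -ix !mulgA bb mul1g bK ix invgK.
have Nr : N (a * b).
  split=> [y /commute_sym //|].
  by rewrite invgM aV bV -!mulgA bb mulg1.
(* Each element of the dihedral group is a rotation or a rotation times b. *)
have: generated [set a; b] `<=` [set x | N x \/ N (x * b)].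
  apply: generated_sub => [|x [] ->]; [|by right|by right; rewrite bb].
  split=> [|x y [Nx|Nx] [Ny|Ny]|x [Nx|Nx]]; first by left.
  - by left; apply: NM.
  - by right; rewrite -mulgA; apply: NM.
  - right; have -> : x * y * b = x * b * y^-1 by case: Ny => _ <-; rewrite !mulgA bK.
    by apply/NM/NV.
  - left; have -> : x * y = x * b * (y * b)^-1.
      by case: Ny => _ <-; rewrite !mulgA !bK.
    by apply/NM/NV.
  - by left; apply: NV.
  - right; have [_ ] := NV _ Nx; rewrite invgK invgM bV mulgA bb mul1g.
    by move=> ->.
move=> sub /sub Nc cb.
(* A rotation commuting with b also commutes with a = (a * b) * b. *)
have key x : N x -> commute x b -> commute x a.
  move=> [cx _] xb; have -> : a = a * b * b by rewrite bK.
  by apply: commuteM => //; apply: cx.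
case: Nc => [Nc|Nc]; [left|right]; apply: key => //.
by apply: commute_sym; apply: commuteM => //; apply: commute_sym.
Qed.

(** The elements p and q commute with the reflection p * q, so if one of them
    were in the dihedral group <a, p * q>, then by [commute_dihedral] p or q
    would commute with a. *)
Lemma dihedral_cap_klein a p q x :
  a * a = 1 -> p * p = 1 -> q * q = 1 -> commute p q ->
  ~ commute p a -> ~ commute q a ->
  generated [set a; p * q] x -> generated [set p; q] x ->
  generated [set p * q] x.
Proof.
move=> aa pp qq pq pa qa Dx.
have qpq : q * (p * q) = p by rewrite pq mulgA qq mul1g.
have bb : p * q * (p * q) = 1 by rewrite -mulgA qpq.
have D c : generated [set a; p * q] c -> commute c (p * q) ->
    ~ (commute c a \/ commute (c * (p * q)) a) -> False.
  by move=> Dc cb; apply; apply: commute_dihedral.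
case/generated_setU => [s t -> -> //|g [h] [/(generated_set1 pp) Pg]].
move=> /(generated_set1 qq) Qh xE.
case: Pg Qh => -> [] -> in xE; rewrite ?mul1g ?mulg1 in xE; rewrite {}xE in Dx *.
- exact: generated1.
- exfalso; apply: (D q) => //.
    by apply: commuteM; [exact: commute_sym|].
  by rewrite qpq; case.
- exfalso; apply: (D p) => //; first exact: commuteM.
  by rewrite mulgA pp mul1g; case.
- exact: sub_generated.
Qed.

End Dihedral.

(** * Products of two involutions *)

Section Involutions.
Variable G : groupType.
Implicit Types x y : G.

Lemma involution_sqr x : involution x -> x * x = 1.
Proof. by case=> _ <- _. Qed.

Lemma involution_neq1 x : involution x -> x <> 1.
Proof. by case=> _ _ /(_ 1%N)/=; rewrite expg1; apply. Qed.

Lemma sqr_involution x : x * x = 1 -> x <> 1 -> involution x.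
Proof.
by move=> xx x1; split=> // -[|[|j]] //; rewrite expg1.
Qed.

Lemma commute_involutions x y :
  x * x = 1 -> y * y = 1 -> (x * y) ^+ 2 = 1 <-> commute x y.
Proof.
move=> xx yy; rewrite expg2; split=> [/mulg1_eq|xy].
  by rewrite invgM (mulg1_eq xx) (mulg1_eq yy).
by rewrite {2}xy mulgA -(mulgA x) yy mulg1.
Qed.

Lemma order_gt2_noncommute x y :
  x * x = 1 -> y * y = 1 -> order_gt (x * y) 2 -> ~ commute x y.
Proof.
move=> xx yy gt2 /(commute_involutions xx yy) xy2.
have [xy1|xy1] := pselect (x * y = 1).
  by suff: (2 < 1)%N by []; apply: gt2; split=> [||[|[|]]] //; rewrite expg1.
by have := gt2 2; rewrite ltnn => /(_ (sqr_involution xy2 xy1)).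
Qed.

End Involutions.

(** * Subgroups generated by some entries of a sequence *)

Section Parabolic.
Variable G : groupType.
Implicit Types (s : seq G) (I J : set nat) (x : G).

Definition parabolic s I : set G := generated [set s`_i | i in I].

Lemma mem_parabolic s I i : I i -> parabolic s I s`_i.
Proof. by move=> Ii; apply: sub_generated; exists i. Qed.

Lemma parabolic_le s I T :
  (forall i, I i -> generated T s`_i) -> parabolic s I `<=` generated T.
Proof. by move=> sIT; apply: generated_le => _ [i Ii <-]; exact: sIT. Qed.

Lemma parabolicS s I J : I `<=` J -> parabolic s I `<=` parabolic s J.
Proof. by move=> IJ; apply: parabolic_le => i /IJ; exact: mem_parabolic. Qed.

Lemma parabolic0 s x : parabolic s set0 x -> x = 1.
Proof.
move=> sx; suff: generated [set (1 : G)] x.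
  by move/(generated_set1 (mulg1 1)) => [].
by move: x sx; apply: parabolic_le.
Qed.

Lemma parabolic_setU s I J x :
  (forall i j, I i -> J j -> commute s`_i s`_j) ->
  parabolic s (I `|` J) x ->
  exists g h, [/\ parabolic s I g, parabolic s J h & x = g * h].
Proof.
move=> cIJ; rewrite /parabolic image_setU; apply: generated_setU.
by move=> _ _ [i Ii <-] [j Jj <-]; exact: cIJ.
Qed.

End Parabolic.

(** * Rank reduction *)

Section RankReduction.
Variables (G : groupType) (n : nat) (rho : seq G).
Hypothesis hn : (4 <= n)%N.
Hypothesis hC : string_Cgroup n rho.
Hypothesis hirr : irreducible n rho.
Hypothesis h0 : generated [set rho`_0 * rho`_2; rho`_3] rho`_0.
Implicit Types (I J K : set nat) (x : G).

Let sigma := [:: rho`_1, rho`_0 * rho`_2 & drop 3 rho].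

Let sigmaS k : sigma`_k.+2 = rho`_k.+3.
Proof. by rewrite /sigma /= nth_drop. Qed.

Let rho_sqr i : (i < n)%N -> rho`_i * rho`_i = 1.
Proof. by case: hC => -[_ _ inv _] _ /inv /involution_sqr. Qed.

Let rho_commute i j : (i.+1 < j < n)%N -> commute rho`_i rho`_j.
Proof.
case/andP=> ij jn; have ltin : (i < n)%N by rewrite (ltn_trans _ jn) 1?ltnW.
apply/(commute_involutions (rho_sqr ltin) (rho_sqr jn)).
by case: hC => -[_ _ _ com] _; apply: com; rewrite ?ij.
Qed.

Let lt4 k : (k < 4)%N -> (k < n)%N.
Proof. by move=> k4; exact: leq_trans hn. Qed.

Let rho_cap I J x : I `<=` `I_n -> J `<=` `I_n ->
  parabolic rho I x -> parabolic rho J x -> parabolic rho (I `&` J) x.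
Proof. by case: hC => _ cap In Jn Ix Jx; rewrite /parabolic -cap. Qed.

(** The only new generator whose word involves the k-th old one. *)
Definition source_index k : nat :=
  match k with 0 => 1%N | 1%N => 0 | k'.+1 => k' end.

(** The indices of the old generators occurring in the words of the new
    generators with index in I; as a preimage it commutes with intersections
    by computation. *)
Let hull I := source_index @^-1` I.

Let hull_bounded I : I `<=` `I_n.-1 -> hull I `<=` `I_n.
Proof.
move=> In [|[|k]] /In /=; try by move=> _; exact: leq_trans hn.
by rewrite ltn_predRL.
Qed.

Let sigma_hull I : parabolic sigma I `<=` parabolic rho (hull I).
Proof.
apply: parabolic_le => -[|[|k]] Ik; rewrite ?sigmaS.
- exact: (@mem_parabolic _ rho (hull I) 1%N).
- by apply: generatedM; [apply: (@mem_parabolic _ rho (hull I) 0)|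
    apply: (@mem_parabolic _ rho (hull I) 2)].
- exact: (@mem_parabolic _ rho (hull I) k.+3).
Qed.

(** When 1 and 2 are both in I, [h0] splits s_1 = r_0 r_2 into its factors. *)
Let hull_sigma I : (I 1%N -> I 2) -> parabolic rho (hull I) `<=` parabolic sigma I.
Proof.
move=> I12.
have I0 : I 1%N -> parabolic sigma I rho`_0.
  move=> I1; move: h0; apply: generated_le => x [] ->.
    exact: (@mem_parabolic _ sigma I 1%N).
  by rewrite -(sigmaS 0); apply: mem_parabolic; apply: I12.
apply: parabolic_le => -[|[|[|k]]] hk.
- exact: I0.
- exact: (@mem_parabolic _ sigma I 0).
- have -> : rho`_2 = (rho`_0)^-1 * (rho`_0 * rho`_2) by rewrite mulKg.
  apply: generatedM; first by apply: generatedV; exact: I0.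
  exact: (@mem_parabolic _ sigma I 1%N).
- by rewrite -sigmaS; exact: mem_parabolic.
Qed.

(** The index 3 is left out: r_3 is the entry that links both sides, and it is
    absent from the products that this lemma is used to split. *)
Let rho_low_high x : parabolic rho `I_3 x ->
  parabolic rho [set k | (3 < k < n)%N] x -> x = 1.
Proof.
move=> lx hx; apply: (@parabolic0 _ rho).
suff <- : `I_3 `&` [set k | (3 < k < n)%N] = set0.
  apply: rho_cap => // k /=; last by case/andP.
  by move=> k3; rewrite (leq_trans k3) // ltnW.
by apply/seteqP; split=> // -[|[|[|k]]] [].
Qed.

(** The case not covered by [hull_sigma]: 1 is in K and 2 is not. Both subgroups
    then split into a part with small indices and a commuting part with large
    ones, and [rho_low_high] makes the two splittings of x agree. *)
Let sigma_cap_hull K I x :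
  I `<=` `I_n.-1 -> K `<=` I -> K 1%N -> ~ I 2 ->
  parabolic sigma I x -> parabolic rho (hull K) x -> parabolic sigma K x.
Proof.
move=> In KI K1 I2 sIx rKx.
pose Il := I `&` `I_2; pose Ih := I `&` [set k | (2 < k)%N].
pose Kl := hull K `&` `I_3.
pose Kh := hull K `&` [set k | (3 < k)%N].
have hKn : hull K `<=` `I_n by apply: hull_bounded; apply: subset_trans In.
have [g [h [Ig Ih_h xE]]] : exists g h,
    [/\ parabolic sigma Il g, parabolic sigma Ih h & x = g * h].
  apply: parabolic_setU.
    move=> i [|[|[|j]]] [_ i2] [/In jn j2] //; rewrite sigmaS.
    have jn' : (j.+4 < n)%N by rewrite -ltn_predRL.
    case: i i2 => [|[|]] // _ /=; first by apply: rho_commute; rewrite jn'.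
    apply/commute_sym; apply: commuteM; apply/commute_sym;
      by apply: rho_commute; rewrite jn'.
  move: sIx; apply: parabolicS => -[|[|[|k]]] Ik //; [by left|by left|by right].
have [g' [h' [Kg Kh_h xE']]] : exists g h,
    [/\ parabolic rho Kl g, parabolic rho Kh h & x = g * h].
  apply: parabolic_setU.
    move=> i j [_ /= i3] [/hKn /= jn j3]; apply: rho_commute.
    by rewrite jn (leq_trans _ j3).
  move: rKx; apply: parabolicS => -[|[|[|[|k]]]] Kk; try by left.
    by case: I2; apply: KI.
  by right.
have gl : parabolic rho `I_3 g.
  move: (sigma_hull Ig); apply: parabolicS.
  by move=> [|[|[|k]]] [].
have hh : parabolic rho [set k | (3 < k < n)%N] h.
  move: (sigma_hull Ih_h); apply: parabolicS.
  move=> [|[|[|k]]] [] //= /In /= kn k2; apply/andP; split=> //.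
  by rewrite -ltn_predRL.
have g'l : parabolic rho `I_3 g'.
  by move: Kg; apply: parabolicS => k [].
have h'h : parabolic rho [set k | (3 < k < n)%N] h'.
  by move: Kh_h; apply: parabolicS => k [/hKn /= kn k3]; rewrite /= k3.
have gh1 : g'^-1 * g = h' * h^-1.
  by apply: (@mulgI _ g'); apply: (@mulIg _ h); rewrite mulVKg !mulgA mulgVK -xE.
have g1 : g'^-1 * g = 1.
  apply: rho_low_high; first by apply: generatedM => //; exact: generatedV.
  by rewrite gh1; apply: generatedM => //; exact: generatedV.
have {g'l} gg' : g' = g by rewrite -(mulg1 g') -g1 mulVKg.
have {h'h} hh' : h' = h by apply: divg1_eq; rewrite -gh1.
rewrite xE; apply: generatedM; last first.
  rewrite -hh'; move: Kh_h; apply: parabolic_le => -[|[|[|k]]] [] // Kk _.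
  by rewrite -sigmaS; apply: mem_parabolic.
(* If 0 is in K, then g, a word in s_0 and s_1, is fine as it stands. If not,
   then hull K omits 1, which puts g = g' into <r_0, r_2>. *)
have [K0|K0] := pselect (K 0).
  by move: Ig; apply: parabolicS => -[|[|k]] [].
have : generated [set rho`_0 * rho`_2] g; last first.
  by apply: generated_le => _ ->; exact: (@mem_parabolic _ sigma K 1%N).
apply: (@dihedral_cap_klein _ rho`_1).
- exact/rho_sqr/lt4.
- exact/rho_sqr/lt4.
- exact/rho_sqr/lt4.
- by apply: rho_commute; rewrite lt4.
- by apply: order_gt2_noncommute; [exact/rho_sqr/lt4|exact/rho_sqr/lt4|exact/hirr/lt4].
- by move/commute_sym; apply: order_gt2_noncommute;
    [exact/rho_sqr/lt4|exact/rho_sqr/lt4|exact/hirr/lt4].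
- by move: Ig; apply: parabolic_le => -[|[|k]] [] // _ _; apply: sub_generated;
    [left|right].
- by rewrite -gg'; move: Kg; apply: parabolic_le => -[|[|[|k]]] [] // _ _;
    apply: sub_generated; [left|right].
Qed.

Let sigma_involution i : (i < n.-1)%N -> involution sigma`_i.
Proof.
have rho_inv k : (k < n)%N -> involution rho`_k.
  by case: hC => -[_ _ inv _] _; exact: inv.
case: i => [|[|i]] ltin; rewrite ?sigmaS; first exact/rho_inv/lt4.
  have r0 := rho_sqr (@lt4 0 isT); have r2 := rho_sqr (@lt4 2 isT).
  apply: sqr_involution => [|/mulg1_eq].
    rewrite -expg2; apply/(commute_involutions r0 r2).
    by apply: rho_commute; rewrite lt4.
  (* If r_0 r_2 = 1, then r_0 = r_2 lies in <r_0> and in <r_2>, which meet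
     trivially. *)
  rewrite (mulg1_eq r0) => r02.
  apply: (@involution_neq1 _ rho`_0); first exact/rho_inv/lt4.
  apply: (@parabolic0 _ rho).
  suff <- : [set 0] `&` [set 2] = set0 :> set nat.
    apply: rho_cap; [by move=> _ ->; exact: lt4..|exact: mem_parabolic|].
    by rewrite r02; exact: mem_parabolic.
  by apply/seteqP; split=> // k [] ->.
by apply: rho_inv; rewrite -ltn_predRL.
Qed.

Let sigma_commute i j : (i.+1 < j < n.-1)%N -> commute sigma`_i sigma`_j.
Proof.
case: j => [|[|j]] // /andP[ij jn]; rewrite sigmaS.
have jn' : (j.+3 < n)%N by rewrite -ltn_predRL.
case: i ij => [|[|i]] ij; rewrite ?sigmaS.
- by apply: rho_commute; rewrite jn'.
- apply/commute_sym; apply: commuteM; apply/commute_sym;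
    by apply: rho_commute; rewrite jn' ?andbT // ltnW.
- by apply: rho_commute; rewrite jn' andbT.
Qed.

(** Of two index sets whose intersection contains 1 but not 2, one must omit 2;
    that one plays the part of I in [sigma_cap_hull]. *)
Theorem rank_reduction : string_Cgroup n.-1 sigma.
Proof.
case: (hC) => -[rho_size rho_gen _ _] _.
split; [split|].
- by rewrite /= size_drop rho_size; case: (n) (hn) => [|[|[|[|m]]]].
- apply/seteqP; split=> // x _; rewrite -/(parabolic _ _).
  apply: hull_sigma; first by move=> _ /=; rewrite ltn_predRL.
  have: parabolic rho `I_n x by rewrite /parabolic rho_gen.
  by apply: parabolicS => -[|[|k]] kn; rewrite /hull /= ltn_predRL //; exact: leq_trans hn.
- exact: sigma_involution.
- move=> i j ltin ltjn ij.
  have si := involution_sqr (sigma_involution ltin).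
  have sj := involution_sqr (sigma_involution ltjn).
  apply/(commute_involutions si sj).
  case/orP: ij => ij; [|apply: commute_sym];
    by apply: sigma_commute; rewrite ij.
- move=> I J In Jn; apply/seteqP; split=> x; rewrite -!/(parabolic _ _); last first.
    by move=> IJx; split; move: x IJx; apply: parabolicS => k [].
  move=> [Ix Jx].
  have Kx : parabolic rho (hull (I `&` J)) x.
    by apply: rho_cap; [exact: hull_bounded..|exact: sigma_hull|exact: sigma_hull].
  have [K1|nK1] := pselect ((I `&` J) 1%N); last exact: hull_sigma.
  have [I2|nI2] := pselect (I 2).
    have [J2|nJ2] := pselect (J 2); first exact: hull_sigma.
    by apply: (@sigma_cap_hull _ J) => // k [].
  by apply: (@sigma_cap_hull _ I) => // k [].
Qed.

End RankReduction.

Theorem corollary1p2 (G : groupType) (n : nat) (rho : seq G)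
    (hn : (4 <= n)%N)
    (hC : string_Cgroup n rho) (hirr : irreducible n rho)
    (hodd : odd_order (rho`_2 * rho`_3)) :
  string_Cgroup n.-1 [:: rho`_1, rho`_0 * rho`_2 & drop 3 rho].
Proof.
apply: rank_reduction => //.
have lt k : (k < 4)%N -> (k < n)%N by move=> k4; exact: leq_trans hn.
case: hC => -[_ _ inv com] _; case: hodd => k [_ rk _] oddk.
have sqr i : (i < 4)%N -> rho`_i * rho`_i = 1.
  by move=> i4; exact/involution_sqr/inv/lt.
have c0 i : (1 < i < 4)%N -> commute rho`_0 rho`_i.
  move=> /andP[i1 i4]; apply/(commute_involutions (sqr 0 isT) (sqr i i4)).
  by apply: com; rewrite ?lt ?i1.
have c : commute rho`_0 (rho`_2 * rho`_3) by apply: commuteM; exact: c0.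
have pow : (rho`_0 * rho`_2 * rho`_3) ^+ k = rho`_0.
  (* As k is odd, the power of the involution rho`_0 is itself. *)
  rewrite -mulgA expgMn // rk mulg1 -(odd_double_half k) oddk.
  by rewrite expgnDr expg1 -muln2 mulnC expgnA expg2 sqr // expg1n mulg1.
rewrite -{2}pow; elim: k {pow rk oddk} => [|k IHk]; first exact: generated1.
rewrite expgS; apply: generatedM => //.
by apply: generatedM; apply: sub_generated; [left|right].
Qed.
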